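(* Let $f$ be a real-valued univariate function with domain $[0,U)$, where $U\in\{w\in\mathbb{R}: w>0\}\cup\{+\infty\}$. Assume that $f(0)=0$ and that $f$ is twice differentiable at every $\delta\in(0,U)$. Suppose further that $f$ is continuous on $[0,U)$ and thrice differentiable on $(0,U)$, and that $f'''$ is decreasing on $(0,U)$. For each $\delta\in(0,U)$, let $g$ (depending on $\delta$) be the $\delta$-smoothing of $f$ and let $$\|f-g\|_\infty:=\max_{w\in[0,\delta]}|f(w)-g(w)|.$$ Then $\|f-g\|_\infty$, as a function of $\delta$, is increasing on $(0,U)$.
   Context: Given $f$ on $[0,U)$ with $f(0)=0$ and $f$ twice differentiable at $\delta\in(0,U)$, the $\delta$-smoothing of $f$ is the function $g$ on $[0,U)$ defined by $g(w)=g_1w+\frac12 g_2w^2+\frac16 g_3w^3$ for $0\le w\le\delta$ and $g(w)=f(w)$ for $\delta<w<U$, where $$g_1=\frac{3f(\delta)}{\delta}-2f'(\delta)+\frac{\delta f''(\delta)}{2},\quad g_2=-\frac{6f(\delta)}{\delta^2}+\frac{6f'(\delta)}{\delta}-2f''(\delta),\quad g_3=\frac{6f(\delta)}{\delta^3}-\frac{6f'(\delta)}{\delta^2}+\frac{3f''(\delta)}{\delta}.$$ Increasing and decreasing are meant strictly: $\phi$ is increasing (decreasing) if $\phi(w_1)<\phi(w_2)$ (resp. $\phi(w_1)>\phi(w_2)$) for all $w_1<w_2$. *)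

(* Defs.v *)
From HB Require Import structures.
From mathcomp Require Import all_boot all_order all_algebra.
From mathcomp Require Import all_classical all_reals all_analysis.

Set Implicit Arguments.
Unset Strict Implicit.
Unset Printing Implicit Defensive.

Import Order.TTheory GRing.Theory Num.Theory.
Import numFieldNormedType.Exports.

Local Open Scope ring_scope.
Local Open Scope classical_set_scope.

(* The right endpoint is an extended real, so that it may be [+oo]. *)
Definition itv0co (R : realType) (U : \bar R) : set R :=
  [set w | 0 <= w /\ (w%:E < U)%E].

Definition itv0oo (R : realType) (U : \bar R) : set R :=
  [set w | 0 < w /\ (w%:E < U)%E].

(* [f^`(k)] is a total function with unspecified values where the derivative
   does not exist; hence every lower-order derivative is required to exist
   near [x], and [f^`(n.-1)] to be differentiable at [x]. *)
Definition n_derivable (R : realType) (f : R -> R) (n : nat) (x : R) : Prop :=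
  (forall k : nat, (k < n)%N -> derivable f^`(k) x 1) /\
  (forall k : nat, (k.+1 < n)%N -> \forall y \near x, derivable f^`(k) y 1).

Definition increasing_on (R : realType) (A : set R) (phi : R -> R) : Prop :=
  forall w1 w2 : R, A w1 -> A w2 -> w1 < w2 -> phi w1 < phi w2.

Definition decreasing_on (R : realType) (A : set R) (phi : R -> R) : Prop :=
  forall w1 w2 : R, A w1 -> A w2 -> w1 < w2 -> phi w1 > phi w2.

Section Smoothing.
Context {R : realType}.
Implicit Types (f : R -> R) (d w : R).

Definition smooth_g1 f d : R :=
  3 * f d / d - 2 * f^`()%classic d + d * f^`(2)%classic d / 2.

Definition smooth_g2 f d : R :=
  - (6 * f d / d ^+ 2) + 6 * f^`()%classic d / d - 2 * f^`(2)%classic d.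

Definition smooth_g3 f d : R :=
  6 * f d / d ^+ 3 - 6 * f^`()%classic d / d ^+ 2 + 3 * f^`(2)%classic d / d.

(* Only meaningful on the domain of [f], in particular for [0 <= w]. *)
Definition smoothing f d w : R :=
  if w <= d then
    smooth_g1 f d * w + 1 / 2 * smooth_g2 f d * w ^+ 2
      + 1 / 6 * smooth_g3 f d * w ^+ 3
  else f w.

Definition is_max (S : set R) (m : R) : Prop := S m /\ ubound S m.

(* The maximum of [S], with junk value [0] if [S] has no greatest element. *)
Definition set_max (S : set R) : R := xget 0 [set m | is_max S m].

Definition smoothing_errors f d : set R :=
  [set `|f w - smoothing f d w| | w in [set w | 0 <= w <= d]].

Definition smoothing_dist f d : R := set_max (smoothing_errors f d).

End Smoothing.

(* Main.v *)
Require Import Defs.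
From HB Require Import structures.
From mathcomp Require Import all_boot all_order all_algebra.
From mathcomp Require Import all_classical all_reals all_analysis.
From mathcomp Require Import ring.

Import Order.TTheory GRing.Theory Num.Theory.
Import numFieldNormedType.Exports.

Local Open Scope ring_scope.
Local Open Scope classical_set_scope.

(** Write g_d for the d-smoothing of f.  On [0, d] it is the cubic that vanishes
    at 0 and agrees with f to second order at d; its third derivative is the
    constant [smooth_g3 f d].

    The heart of the matter is that, for fixed w > 0, the value g_d(w) is
    strictly decreasing in d on d >= w ([smoothing_decreasing]).  Differentiate
    in d: the result, as a function of w, is again a cubic, it vanishes at 0,
    and differentiating the contact conditions along the diagonal w = d shows
    that it has a double zero at w = d, with second derivative
    f'''(d) - [smooth_g3 f d] there.  Hence it is
    (f'''(d) - [smooth_g3 f d]) / 2 * w * (w - d)^2 / d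
    ([is_derive_smoothing_poly]).  Its sign is negative: f - g_d vanishes at 0
    and has a triple zero at d, so three applications of Rolle's theorem give
    [smooth_g3 f d] = f'''(c) with 0 < c < d, and f''' is strictly decreasing
    ([smooth_g3_gt]).

    Since g_w(w) = f(w), this monotonicity yields everything else.  The error
    f(w) - g_d(w) = g_w(w) - g_d(w) is positive for 0 < w < d, so absolute
    values can be dropped; and for fixed w it strictly increases with d.
    Comparing the errors for d1 < d2 at a point where the maximum for d1 is
    attained gives the strict inequality between the maxima. *)

(** * Derivability and domains *)

Lemma n_derivable_is_derive {R : realType} {f : R -> R} {n k : nat} {x : R} :
  n_derivable f n x -> (k < n)%N -> is_derive x 1 f^`(k) (f^`(k.+1) x).
Proof.
move=> [fx _] kn; rewrite derive1nS derive1E.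
by apply: derivableP; exact: fx.
Qed.

Lemma itv0oo_le {R : realType} {U : \bar R} {x d : R} :
  itv0oo U d -> 0 < x -> x <= d -> itv0oo U x.
Proof.
by move=> [_ dU] x0 xd; split=> //; apply: le_lt_trans dU; rewrite lee_fin.
Qed.

Lemma itv0oo_subset_dom {R : realType} {U : \bar R} {d : R} :
  itv0oo U d -> `[0, d]%classic `<=` itv0co U.
Proof.
move=> [_ dU] x /=; rewrite in_itv/= => /andP[x0 xd].
by split=> //; apply: le_lt_trans dU; rewrite lee_fin.
Qed.

Lemma within_continuous_horner {R : realType} (A : set R) (p : {poly R}) :
  {within A, continuous (horner p)}.
Proof. by apply: continuous_subspaceT => x; exact: continuous_horner. Qed.

(** * Rolle's theorem for an osculating polynomial *)

(** Rolle's theorem three times, applied to f - p: the zero at [a] and the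
    triple zero at [b] push a zero of each successive derivative into the open
    interval.  At [a] only continuity is asked for, because in the application
    f need not be differentiable at the left end of its domain. *)
Lemma osculating_poly_derive3 {R : realType} (f f1 f2 f3 : R -> R)
    (p : {poly R}) (a b : R) :
  a < b ->
  {within `[a, b], continuous f} ->
  (forall x, a < x <= b -> is_derive x 1 f (f1 x)) ->
  (forall x, a < x <= b -> is_derive x 1 f1 (f2 x)) ->
  (forall x, a < x <= b -> is_derive x 1 f2 (f3 x)) ->
  p.[a] = f a -> p.[b] = f b -> p^`().[b] = f1 b -> p^`(2).[b] = f2 b ->
  exists2 c, a < c < b & f3 c = p^`(3).[c].
Proof.
move=> ab fc D1 D2 D3 pa pb p1b p2b.
have der (q : {poly R}) (g dg : R -> R) (x : R) : is_derive x 1 g (dg x) ->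
    is_derive x 1 (g - horner q) (dg x - q^`().[x]).
  by move=> gx; exact: is_deriveB.
(* One use of Rolle, between the last zero found, [y], and the zero at [b]. *)
have step (q : {poly R}) (g dg : R -> R) y : a <= y -> y < b ->
    (forall x, a < x <= b -> is_derive x 1 g (dg x)) ->
    {within `[y, b], continuous g} ->
    q.[y] = g y -> q.[b] = g b ->
    exists2 z, y < z < b & q^`().[z] = dg z.
  move=> ay yb dgx gc qy qb.
  have [|||z] := @Rolle R (g - horner q) y b yb.
  - move=> x; rewrite in_itv/= => /andP[yx xb].
    have [] // := der q g dg x; apply: dgx.
    by rewrite (le_lt_trans ay yx) ltW.
  - by apply: within_continuousB => //; exact: within_continuous_horner.
  - by rewrite !fctE qy qb !subrr.
  rewrite in_itv/= => /andP[yz zb] [_ h0]; exists z; first by rewrite yz.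
  have [_ h1] : is_derive z 1 (g - horner q) (dg z - q^`().[z]).
    by apply: der; apply: dgx; rewrite (le_lt_trans ay yz) ltW.
  by apply/esym/eqP; rewrite -subr_eq0 -h1 h0.
have cont (g dg : R -> R) y : a < y ->
    (forall x, a < x <= b -> is_derive x 1 g (dg x)) ->
    {within `[y, b], continuous g}.
  move=> ay dgx; apply: derivable_within_continuous => x.
  rewrite in_itv/= => /andP[yx xb].
  by have [] // := dgx x; rewrite (lt_le_trans ay yx).
have [x1 /andP[ax1 x1b] e1] := step p f f1 a (lexx _) ab D1 fc pa pb.
have [x2 /andP[x12 x2b] e2] :=
  step _ _ _ _ (ltW ax1) x1b D2 (cont _ _ _ ax1 D2) e1 p1b.
have ax2 := lt_trans ax1 x12.
have [x3 /andP[x23 x3b] e3] :=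
  step _ _ _ _ (ltW ax2) x2b D3 (cont _ _ _ ax2 D3) e2 p2b.
by exists x3; [rewrite (lt_trans ax2 x23)|].
Qed.

(** * The cubic piece of the smoothing *)

(** The cubic piece without the case distinction on w <= d: this is what can be
    differentiated both in w and in d. *)
Definition smoothing_poly {R : realType} (f : R -> R) (d : R) : {poly R} :=
  smooth_g1 f d *: 'X + (1 / 2 * smooth_g2 f d) *: 'X^2
    + (1 / 6 * smooth_g3 f d) *: 'X^3.

Lemma horner_smoothing_poly {R : realType} (f : R -> R) (d w : R) :
  (smoothing_poly f d).[w] =
  smooth_g1 f d * w + 1 / 2 * smooth_g2 f d * w ^+ 2
    + 1 / 6 * smooth_g3 f d * w ^+ 3.
Proof. by rewrite !(hornerD, hornerZ, hornerX, hornerXn). Qed.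

Lemma smoothing_polyE {R : realType} (f : R -> R) (d w : R) :
  w <= d -> (smoothing_poly f d).[w] = smoothing f d w.
Proof. by move=> wd; rewrite horner_smoothing_poly /smoothing wd. Qed.

Lemma smoothing_diag {R : realType} (f : R -> R) (d : R) :
  0 < d -> smoothing f d d = f d.
Proof.
move=> d0; rewrite /smoothing lexx /smooth_g1 /smooth_g2 /smooth_g3.
by field; rewrite gt_eqF.
Qed.

Lemma deriv1_smoothing_poly {R : realType} (f : R -> R) (d : R) :
  (smoothing_poly f d)^`()%R =
  (smooth_g1 f d)%:P + smooth_g2 f d *: 'X + (1 / 2 * smooth_g3 f d) *: 'X^2.
Proof.
rewrite /smoothing_poly !derivD !derivZ derivX !derivXn /= expr1 alg_polyC.
rewrite -(scaler_nat 2 'X) -(scaler_nat 3 'X^2) !scalerA.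
by congr (_ + _ *: _ + _ *: _); field.
Qed.

Lemma deriv2_smoothing_poly {R : realType} (f : R -> R) (d : R) :
  (smoothing_poly f d)^`(2)%R = (smooth_g2 f d)%:P + smooth_g3 f d *: 'X.
Proof.
rewrite derivnS derivn1 deriv1_smoothing_poly.
rewrite !derivD !derivZ derivC derivX derivXn /= expr1 alg_polyC add0r.
rewrite -(scaler_nat 2 'X) scalerA.
by congr (_ + _ *: _); field.
Qed.

Lemma deriv3_smoothing_poly {R : realType} (f : R -> R) (d : R) :
  (smoothing_poly f d)^`(3)%R = (smooth_g3 f d)%:P.
Proof.
rewrite derivnS deriv2_smoothing_poly.
by rewrite derivD derivZ derivC derivX alg_polyC add0r.
Qed.

(** The cubic piece osculates f at [d] and meets it again at 0, so some value of
    f''' equals its third derivative, which is constant. *)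
Lemma smooth_g3_derive3 {R : realType} (f : R -> R) (d : R) :
  0 < d -> f 0 = 0 -> {within `[0, d], continuous f} ->
  (forall x, 0 < x <= d -> n_derivable f 3 x) ->
  exists2 c, 0 < c < d & f^`(3) c = smooth_g3 f d.
Proof.
move=> d0 f0 fc f3.
have D k x : (k < 3)%N -> 0 < x <= d -> is_derive x 1 f^`(k) (f^`(k.+1) x).
  by move=> k3 xd; apply: n_derivable_is_derive k3; exact: f3.
have dn0 : d != 0 by rewrite gt_eqF.
have [||||c cd f3c] := osculating_poly_derive3 f _ _ _ (smoothing_poly f d) _ _
  d0 fc (D 0%N ^~ isT) (D 1%N ^~ isT) (D 2%N ^~ isT).
- by rewrite smoothing_polyE ?ltW// /smoothing ltW// f0; ring.
- by rewrite smoothing_polyE// smoothing_diag.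
- rewrite deriv1_smoothing_poly !(hornerD, hornerZ, hornerC, hornerX, hornerXn).
  by rewrite /smooth_g1 /smooth_g2 /smooth_g3 derive1n1; field.
- rewrite deriv2_smoothing_poly !(hornerD, hornerZ, hornerC, hornerX, hornerXn).
  by rewrite /smooth_g2 /smooth_g3; field.
by exists c => //; rewrite f3c deriv3_smoothing_poly hornerC.
Qed.

(** * Dependence of the smoothing on the contact point *)

(** As a function of w the derivative is a cubic.  The factor w is there because
    every g_d vanishes at 0, and the factor (w - s)^2 because differentiating
    g_d(d) = f(d) and g_d'(d) = f'(d) in d leaves no contribution of the moving
    contact point to the value and the slope at w = s. *)
Lemma is_derive_smoothing_poly {R : realType} (f : R -> R) (s w : R) :
  0 < s -> n_derivable f 3 s ->
  is_derive s 1 (fun d => (smoothing_poly f d).[w])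
    ((f^`(3)%classic s - smooth_g3 f s) / 2 * w * (w - s) ^+ 2 / s).
Proof.
move=> s0 fs.
have sn0 : s != 0 by rewrite gt_eqF.
have D k : (k < 3)%N -> is_derive s 1 f^`(k) (f^`(k.+1) s).
  exact: n_derivable_is_derive.
have D0 : is_derive s 1 f (f^`()%classic s) := D 0%N isT.
have D1 : is_derive s 1 f^`()%classic (f^`(2)%classic s) := D 1%N isT.
have D2 := D 2%N isT.
(* The product rule with multiplication instead of scaling on R, so that field
   can read the resulting expressions. *)
have M (g h : R -> R) dg dh : is_derive s 1 g dg -> is_derive s 1 h dh ->
    is_derive s 1 (g * h) (g s * dh + h s * dg).
  exact: is_deriveM.
have Z (a : R) (g : R -> R) dg :
    is_derive s 1 g dg -> is_derive s 1 (cst a * g) (a * dg).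
  move=> Dg; apply: is_derive_eq (M _ _ _ _ (is_derive_cst a s 1) Dg) _.
  by rewrite mulr0 addr0.
pose v : R -> R := fun d => d^-1.
have Dv : is_derive s 1 v (- s ^- 2).
  apply: DeriveDef; first exact: derivableV.
  by rewrite deriveV// derive_id scaler1.
have Dv2 := M _ _ _ _ Dv Dv.
have Dv3 := M _ _ _ _ Dv Dv2.
(* The coefficients of the cubic as functions of the contact point, written as
   combinations of functions, the form on which the derivation rules act. *)
pose g1 : R -> R :=
  cst 3 * (f * v) - cst 2 * f^`()%classic + cst 2^-1 * (id * f^`(2)%classic).
pose g2 : R -> R :=
  cst 6 * (f^`()%classic * v) - cst 6 * (f * (v * v)) - cst 2 * f^`(2)%classic.
pose g3 : R -> R := cst 6 * (f * (v * (v * v)))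
  - cst 6 * (f^`()%classic * (v * v)) + cst 3 * (f^`(2)%classic * v).
have -> : (fun d => (smoothing_poly f d).[w]) =
    cst w * g1 + cst (w ^+ 2 / 2) * g2 + cst (w ^+ 3 / 6) * g3.
  apply/funext => d; rewrite horner_smoothing_poly.
  rewrite /smooth_g1 /smooth_g2 /smooth_g3 /g1 /g2 /g3 /v !fctE -!exprVn.
  by ring.
have Dg1 := is_deriveD (is_deriveB (Z 3 _ _ (M _ _ _ _ D0 Dv)) (Z 2 _ _ D1))
  (Z 2^-1 _ _ (M _ _ _ _ (is_derive_id s 1) D2)).
have Dg2 := is_deriveB (is_deriveB (Z 6 _ _ (M _ _ _ _ D1 Dv))
  (Z 6 _ _ (M _ _ _ _ D0 Dv2))) (Z 2 _ _ D2).
have Dg3 := is_deriveD (is_deriveB (Z 6 _ _ (M _ _ _ _ D0 Dv3))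
  (Z 6 _ _ (M _ _ _ _ D1 Dv2))) (Z 3 _ _ (M _ _ _ _ D2 Dv)).
apply: is_derive_eq (is_deriveD (is_deriveD (Z w _ _ Dg1)
  (Z (w ^+ 2 / 2) _ _ Dg2)) (Z (w ^+ 3 / 6) _ _ Dg3)) _.
rewrite /smooth_g3 /v !fctE /=.
(* What remains is a rational identity in s, w and the values at s of f and its
   derivatives. *)
move: (f^`()^`()^`()%classic s) (f^`()^`()%classic s) (f^`()%classic s) (f s).
by move=> a3 a2 a1 a0; field.
Qed.

Lemma smooth_g3_gt {R : realType} (U : \bar R) (f : R -> R) (d : R) :
  f 0 = 0 -> {within itv0co U, continuous f} ->
  (forall x, itv0oo U x -> n_derivable f 3 x) ->
  decreasing_on (itv0oo U) f^`(3) ->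
  itv0oo U d -> f^`(3) d < smooth_g3 f d.
Proof.
move=> f0 fc f3 f3decr Ud; have d0 : 0 < d by case: Ud.
have [||c /andP[c0 cd] <-] := smooth_g3_derive3 f _ d0 f0.
- exact: continuous_subspaceW (itv0oo_subset_dom Ud) fc.
- by move=> x /andP[x0 xd]; apply: f3; exact: itv0oo_le Ud x0 xd.
by apply: f3decr => //; exact: itv0oo_le Ud c0 (ltW cd).
Qed.

(** The mean value theorem in the contact point; the derivative is strictly
    negative because w lies strictly to the left of the intermediate point. *)
Lemma smoothing_decreasing {R : realType} (U : \bar R) (f : R -> R)
    (w d1 d2 : R) :
  f 0 = 0 -> {within itv0co U, continuous f} ->
  (forall x, itv0oo U x -> n_derivable f 3 x) ->
  decreasing_on (itv0oo U) f^`(3) ->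
  0 < w -> w <= d1 -> d1 < d2 -> itv0oo U d2 ->
  smoothing f d2 w < smoothing f d1 w.
Proof.
move=> f0 fc f3 f3decr w0 wd1 d12 Ud2.
have Us s : d1 <= s -> s <= d2 -> itv0oo U s.
  move=> d1s; apply: itv0oo_le Ud2 _.
  by rewrite (lt_le_trans w0)// (le_trans wd1).
pose dG s := (f^`(3)%classic s - smooth_g3 f s) / 2 * w * (w - s) ^+ 2 / s.
have DG s : d1 <= s -> s <= d2 ->
    is_derive s 1 (fun d => (smoothing_poly f d).[w]) (dG s).
  move=> d1s sd2; have Uss := Us _ d1s sd2.
  by apply: is_derive_smoothing_poly; [case: Uss|exact: f3].
have [||c] := @MVT R (fun d => (smoothing_poly f d).[w]) dG d1 d2 d12.
- by move=> s; rewrite in_itv/= => /andP[/ltW d1s /ltW]; exact: DG.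
- apply: derivable_within_continuous => s; rewrite in_itv/= => /andP[d1s sd2].
  by have [] := DG s d1s sd2.
rewrite in_itv/= => /andP[d1c cd2].
rewrite !smoothing_polyE//; last by rewrite (le_trans wd1)// ltW.
move=> mvt; rewrite -subr_lt0 mvt pmulr_llt0 ?subr_gt0//.
have wc := le_lt_trans wd1 d1c; have c0 := lt_trans w0 wc.
rewrite /dG pmulr_llt0 ?invr_gt0// pmulr_llt0; last first.
  by rewrite exprn_even_gt0//= subr_eq0 lt_eqF.
rewrite pmulr_llt0// pmulr_llt0 ?invr_gt0// subr_lt0.
exact: smooth_g3_gt _ _ _ f0 fc f3 f3decr (Us _ (ltW d1c) (ltW cd2)).
Qed.

(** * The maximal error *)

Lemma set_max_unique {R : realType} {S : set R} {m : R} :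
  is_max S m -> set_max S = m.
Proof.
move=> [Sm mS]; rewrite /set_max; apply: xget_unique => // m' [Sm' m'S].
by apply/eqP; rewrite eq_le mS// m'S.
Qed.

Theorem theorem3p13 (R : realType) (U : \bar R) (f : R -> R)
  (U_gt0 : (0 < U)%E)
  (f0 : f 0 = 0)
  (f_twice : forall d : R, itv0oo U d -> n_derivable f 2 d)
  (f_cont : {within itv0co U, continuous f})
  (f_thrice : forall d : R, itv0oo U d -> n_derivable f 3 d)
  (f'''_decr : decreasing_on (itv0oo U) f^`(3)) :
  (forall d : R, itv0oo U d ->
     is_max (smoothing_errors f d) (smoothing_dist f d)) /\
  increasing_on (itv0oo U) (smoothing_dist f).
Proof.
have decr w d1 d2 : 0 < w -> w <= d1 -> d1 < d2 -> itv0oo U d2 ->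
    smoothing f d2 w < smoothing f d1 w.
  exact: smoothing_decreasing.
have err0 d : itv0oo U d -> f 0 - smoothing f d 0 = 0.
  by move=> [d0 _]; rewrite /smoothing ltW// f0; ring.
(* The error at w is the difference of the smoothings with contact points w and
   d, evaluated at w. *)
have err_gt0 w d : 0 < w -> w < d -> itv0oo U d -> 0 < f w - smoothing f d w.
  move=> w0 wd Ud; rewrite subr_gt0 -[ltRHS]smoothing_diag//.
  exact: decr.
have err_ge0 w d : 0 <= w -> w <= d -> itv0oo U d -> 0 <= f w - smoothing f d w.
  rewrite le_eqVlt => /predU1P[<- _ /err0 ->//|w0].
  rewrite le_eqVlt => /predU1P[<- _|wd Ud]; last exact/ltW/err_gt0.
  by rewrite smoothing_diag// subrr.
have maxP d : itv0oo U d ->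
    is_max (smoothing_errors f d) (smoothing_dist f d).
  move=> Ud; have [d0 _] := Ud.
  have [||c] := @EVT_max R (f - horner (smoothing_poly f d)) 0 d.
  - exact: ltW.
  - apply: within_continuousB; last exact: within_continuous_horner.
    exact: continuous_subspaceW (itv0oo_subset_dom Ud) f_cont.
  rewrite in_itv/= => /andP[c0 cd] cmax.
  suff cP : is_max (smoothing_errors f d) `|f c - smoothing f d c|.
    by rewrite /smoothing_dist (set_max_unique cP).
  split; first by exists c => //=; rewrite c0 cd.
  move=> _ [t /= /andP[t0 td] <-]; rewrite !ger0_norm ?err_ge0//.
  by have := cmax t; rewrite in_itv/= t0 td !fctE !smoothing_polyE//; exact.
split=> // d1 d2 Ud1 Ud2 d12; have [d10 _] := Ud1.
have [[w /= /andP[w0 wd1] <-] _] := maxP _ Ud1.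
have [_ ub2] := maxP _ Ud2.
have le2 t : 0 <= t -> t <= d2 -> f t - smoothing f d2 t <= smoothing_dist f d2.
  move=> t0 td2; apply: le_trans (ler_norm _) _.
  by apply: ub2; exists t => //=; rewrite t0.
(* If the maximum for [d1] is attained at 0 it is zero, and the error for [d2]
   at [d1] exceeds it; otherwise the two errors are compared at [w]. *)
rewrite ger0_norm ?err_ge0//; move: w0; rewrite le_eqVlt => /predU1P[<-|w0].
  rewrite err0//; apply: lt_le_trans (le2 _ (ltW d10) (ltW d12)).
  exact: err_gt0.
apply: lt_le_trans (le2 _ (ltW w0) (le_trans wd1 (ltW d12))).
by rewrite ltrD2l ltrN2; exact: decr.
Qed.
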